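(* Let $d,N\ge 1$ be integers, put $s=d-1$, and let $F=F_1+\cdots+F_s+F_d$ and $G=G_1+\cdots+G_N$ be elements of $\mathbb{C}[x_1,\ldots,x_n]$, where $F_i$ and $G_j$ are homogeneous polynomials of degree $i$ and $j$, respectively. Assume that $h\in\mathbb{C}[x_1,\ldots,x_n]$ is a homogeneous polynomial that is not a power of any other polynomial of degree $<\deg h$, that $\deg h\mid\gcd(d,N)$, and that $$F_d=h^{d/\deg h}\qquad\text{and}\qquad G_N=a_Nh^{N/\deg h}$$ for some $a_N\in\mathbb{C}\setminus\{0\}$. Put $t=\deg h$ and $r=\frac{d}{t}$. Let $i\in\{1,\ldots,N\}$. If $\deg[F,G]<d+i$, then there are $a_i,\ldots,a_{N-1}\in\mathbb{C}$ such that for every $j=i,i+1,\ldots,N$ we have $$G_j=\sum_{\substack{\alpha=(\alpha_0,\ldots,\alpha_s)\in\mathbb{Z}\times\mathbb{N}^s\\ t\alpha_0+\alpha_1+2\alpha_2+\cdots+s\alpha_s=j\\ t\alpha_0+d(\alpha_1+\cdots+\alpha_s)\le N}} c^{(j)}_{\alpha}\,F_1^{\alpha_1}\cdots F_s^{\alpha_s}h^{\alpha_0},$$ where for $\alpha=(\alpha_0,\ldots,\alpha_s)\in\mathbb{Z}\times\mathbb{N}^s$ with $t\alpha_0+\alpha_1+2\alpha_2+\cdots+s\alpha_s=j$ and $t\alpha_0+d(\alpha_1+\cdots+\alpha_s)\le N$, $$c^{(j)}_{\alpha}=\frac{\prod_{k=1}^{\alpha_1+\cdots+\alpha_s}(\alpha_0+rk)}{\left(\prod_{i_1=1}^{\alpha_1}ri_1\right)\cdots\left(\prod_{i_s=1}^{\alpha_s}ri_s\right)}\;a_{t\alpha_0+d(\alpha_1+\cdots+\alpha_s)}.$$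 Moreover, $a_j=0$ when $\deg h\nmid j$.
   Context: $\mathbb{N}=\{0,1,2,\ldots\}$. For $f,g\in\mathbb{C}[x_1,\ldots,x_n]$ the Poisson bracket is $[f,g]=\sum_{1\le i<j\le n}\left(\frac{\partial f}{\partial x_i}\frac{\partial g}{\partial x_j}-\frac{\partial f}{\partial x_j}\frac{\partial g}{\partial x_i}\right)[x_i,x_j]$, where $[x_i,x_j]=-[x_j,x_i]$ are formal symbols (linearly independent for $i<j$), and $\deg[f,g]=2+\max_{1\le i<j\le n}\deg\left(\frac{\partial f}{\partial x_i}\frac{\partial g}{\partial x_j}-\frac{\partial f}{\partial x_j}\frac{\partial g}{\partial x_i}\right)$, with $\deg 0=-\infty$. A homogeneous component $F_i$ or $G_j$ of lower degree is allowed to be zero. Since $\alpha_0$ may be negative, the identities for $G_j$ are understood in $\mathbb{C}(x_1,\ldots,x_n)$; empty products equal $1$ and $F_l^0=1$ even if $F_l=0$. *)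

(* Defs.v *)
From HB Require Import structures.
From mathcomp Require Export all_boot all_order all_algebra.
From mathcomp Require Export mpoly complex.
From mathcomp Require Export boolp classical_sets functions cardinality fsbigop.
From mathcomp Require Export constructive_ereal reals.
From mathcomp Require Import zify.

Set Implicit Arguments.
Unset Strict Implicit.
Unset Printing Implicit Defensive.

Export Order.TTheory GRing.Theory Num.Theory.

Local Open Scope classical_set_scope.
Local Open Scope ring_scope.

Notation "x %:F" := (@FracField.tofrac _ x) : ring_scope.

Definition deg (n : nat) (K : nzRingType) (p : {mpoly K[n]}) : \bar int :=
  if p == 0 then -oo%E else ((msize p).-1%:Z)%:E.

(* The bracket is an element of the free module on the symbols [x_i, x_j],
   i < j, given by its coordinates. *)
Definition poisson (n : nat) (K : comNzRingType) (f g : {mpoly K[n]}) :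
    {ffun {e : 'I_n * 'I_n | (e.1 < e.2)%N} -> {mpoly K[n]}} :=
  [ffun e => let: (i, j) := val e in
     f^`M(i) * g^`M(j) - f^`M(j) * g^`M(i)].

Definition poisson_deg (n : nat) (K : comNzRingType) (f g : {mpoly K[n]}) :
    \bar int :=
  (2%:E + \big[maxe/-oo]_e deg (poisson f g e))%E.

(* An exponent alpha = (alpha_0, alpha_1, ..., alpha_s) is encoded as the pair
   (alpha.1, alpha.2) with alpha.1 = alpha_0 and alpha.2 l = alpha_(l+1). *)
Notation exponent s := (int * {ffun 'I_s -> nat})%type.

Definition tail_sum (s : nat) (alpha : exponent s) : nat :=
  (\sum_(l < s) alpha.2 l)%N.

Definition weight (s t : nat) (alpha : exponent s) : int :=
  t%:Z * alpha.1 + (\sum_(l < s) l.+1 * alpha.2 l)%N%:Z.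

Definition level (s d t : nat) (alpha : exponent s) : int :=
  t%:Z * alpha.1 + (d * tail_sum alpha)%N%:Z.

Definition admissible (s d N t j : nat) : set (exponent s) :=
  [set alpha | weight t alpha = j%:Z /\ level d t alpha <= N%:Z].

(* When s < d, admissible exponents satisfy j <= level d t alpha <= N, so a is
   only evaluated at indices between j and N. *)
Definition coefc (K : fieldType) (s d t r : nat) (a : int -> K)
    (alpha : exponent s) : K :=
  (\prod_(1 <= k < (tail_sum alpha).+1) (alpha.1%:~R + (r * k)%:R))
  / (\prod_(l < s) \prod_(1 <= m < (alpha.2 l).+1) (r * m)%:R)
  * a (level d t alpha).

(* F_1^alpha_1 ... F_s^alpha_s h^alpha_0 in the field of fractions. *)
Definition monom (n : nat) (K : fieldType) (s : nat) (F : nat -> {mpoly K[n]})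
    (h : {mpoly K[n]}) (alpha : exponent s) : {fraction {mpoly K[n]}} :=
  (\prod_(l < s) (F l.+1)%:F ^+ alpha.2 l) * h%:F ^ alpha.1.

(* \sum_(_ \in _) is 0 by convention on an infinite support; this does not
   happen for sums over admissible exponents. *)
Lemma admissible_finite (s d N t j : nat) :
  (s < d)%N -> (0 < t)%N -> finite_set (@admissible s d N t j).
Proof.
move=> sd t0.
pose g (f : {ffun 'I_s -> 'I_N.+1}) : exponent s :=
  (divz (j%:Z - (\sum_(l < s) l.+1 * f l)%N%:Z) t%:Z,
   [ffun l => nat_of_ord (f l)]).
apply: (@sub_finite_set _ _ (g @` setT)); last first.
  exact/finite_image/finite_finset.
move=> [a0 al]; rewrite /admissible /weight /level /tail_sum /= => -[Hw Hl].
set S := (\sum_(l < s) al l)%N in Hl.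
set W := (\sum_(l < s) l.+1 * al l)%N in Hw.
have Hsum : (W + S <= d * S)%N.
  rewrite /W /S big_distrr -big_split /=; apply: leq_sum => l _.
  by rewrite -mulSnr leq_mul2r; apply/orP; right; have := ltn_ord l; lia.
have Hb l : (al l < N.+1)%N.
  have : (al l <= S)%N by rewrite /S (bigD1 l) //= leq_addr.
  by move: Hw Hl Hsum; clearbody S W; lia.
exists [ffun l => Ordinal (Hb l)] => //; rewrite /g; congr pair.
  under eq_bigr do rewrite ffunE /=.
  by rewrite -/W -Hw addrK mulrC mulzK //; lia.
by apply/ffunP => l; rewrite !ffunE.
Qed.

(* Main.v *)
From HB Require Import structures.
Require Import Defs.
From mathcomp Require Import ring zify.

Set Implicit Arguments.
Unset Strict Implicit.
Unset Printing Implicit Defensive.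

Local Open Scope classical_set_scope.
Local Open Scope ring_scope.

(* Write S_j for the right-hand side of the formula for G_j. The partial
   derivatives of S_j satisfy dS_j = sum_l T_(j-l) dF_l, where l runs over 1, ..., d
   and T depends only on the difference j - l; by antisymmetry
   sum_l dF_l /\ dS_(m-l) = 0 for every m, whatever the constants a_k are. The
   degree bound says that sum_l dF_l /\ dG_(m-l) = 0 for m >= d + i. Going down
   from j = N, where G_l = S_l for l > j, the difference of the two identities at
   m = d + j is dh /\ d(G_j - S_j) = 0. Homogeneity and Euler's identity then make
   a power of G_j - S_j proportional to a power of h; since h is not a proper power
   and polynomials are integrally closed, G_j - S_j is a multiple of h^(j/t), which
   is absorbed by the choice of a_j. *)

(** * Polynomials with zero gradient, and structural induction on polynomials *)

Section Mpoly.
Variables (n : nat) (K : numFieldType).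
Implicit Types (p q A B U V : {mpoly K[n]}) (i : 'I_n).

Lemma mderiv_eq0_const p : (forall i, p^`M(i) = 0) -> p = (p@_0)%:MP.
Proof.
move=> dp; apply/mpolyP => m; rewrite mcoeffC.
have [<-|/eqP m0] := eqVneq 0%MM m; first by rewrite mulr1.
rewrite mulr0; have [i mi] : exists i, m i != 0%N.
  apply/existsP; apply: contra_notT m0 => /existsPn mi0.
  by apply/mnmP => i; rewrite mnm0E; apply/esym/eqP; have := mi0 i; rewrite negbK.
have Em : (m - U_(i) + U_(i))%MM = m.
  by rewrite submK //; apply/mnm_lepP => j; rewrite mnm1E; case: eqP => // <-; lia.
have /(congr1 (fun q => q@_(m - U_(i))%MM)) := dp i.
rewrite mcoeff_deriv mcoeff0 Em => /eqP.
by rewrite mulrn_eq0 /= => /eqP.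
Qed.


End Mpoly.

(** Suited to ring morphisms and derivations: a property that passes to sums and products need only
    be checked on constants and variables. *)
Lemma mpoly_ring_ind (n : nat) (K : nzRingType) (P : {mpoly K[n]} -> Prop) :
  (forall c, P c%:MP) -> (forall i, P 'X_i) ->
  (forall p q, P p -> P q -> P (p + q)) ->
  (forall p q, P p -> P q -> P (p * q)) -> forall p, P p.
Proof.
move=> PC PX PD PM; elim/mpolyind => [|c m p _ _ Pp]; first by rewrite -mpolyC0.
apply: (PD) => //; rewrite -mul_mpolyC; apply: (PM) => //.
rewrite mpolyXE_id; apply: (big_ind P) => [|q r|i _]; [by rewrite -mpolyC1|exact: (PM)|].
elim: (m i) => [|k IH]; first by rewrite expr0 -mpolyC1.
by rewrite exprS; apply: (PM).
Qed.

(** * Restriction of polynomials to lines *)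

Section Lines.
Variables (n : nat) (K : comNzRingType) (S : comNzRingType).
Variables (f : {rmorphism K -> S}) (u y : 'I_n -> S).

(* [p (u + 'X y)] as a polynomial in ['X]. *)
Definition along (p : {mpoly K[n]}) : {poly S} :=
  mmap (polyC \o f) (fun i => (u i)%:P + y i *: 'X) p.

HB.instance Definition _ := GRing.isZmodMorphism.Build _ _ along
  (mmap_is_additive (fun i => (u i)%:P + y i *: 'X) (polyC \o f)).
Fact along_monoid_morphism : monoid_morphism along.
Proof. by have [] := mmap_is_multiplicative (fun i => (u i)%:P + y i *: 'X) (polyC \o f). Qed.
HB.instance Definition _ :=
  GRing.isMonoidMorphism.Build _ _ along along_monoid_morphism.

Lemma alongC c : along c%:MP = (f c)%:P.
Proof. by rewrite /along mmapC. Qed.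

Lemma alongX i : along 'X_i = (u i)%:P + y i *: 'X.
Proof. by rewrite /along mmapX mmap1U. Qed.

Lemma alongD : {morph along : p q / p + q}. Proof. exact: rmorphD. Qed.
Lemma alongM : {morph along : p q / p * q}. Proof. exact: rmorphM. Qed.
Lemma alongXn k : {morph along : p / p ^+ k}. Proof. exact: rmorphXn. Qed.

Lemma deriv_along p : (along p)^`() = \sum_i y i *: along p^`M(i).
Proof.
elim/mpoly_ring_ind: p => [c|i|p q IHp IHq|p q IHp IHq].
- by rewrite alongC derivC big1 // => i _; rewrite mderivC rmorph0 scaler0.
- rewrite alongX derivD derivC add0r derivZ derivX (bigD1 i) //= big1 ?addr0.
    rewrite mderivX mnm1E eqxx scale1r.
    have -> : (U_(i) - U_(i))%MM = 0%MM :> 'X_{1..n}.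
      by apply/mnmP => j; rewrite mnmBE mnm0E subnn.
    by rewrite mpolyX0 rmorph1 alg_polyC.
  move=> j ji; rewrite mderivX mnm1E eq_sym (negbTE ji) scale0r.
  by rewrite rmorph0 scaler0.
- rewrite rmorphD derivD IHp IHq -big_split /=; apply: eq_bigr => i _.
  by rewrite mderivD rmorphD scalerDr.
rewrite rmorphM derivM IHp IHq mulr_suml mulr_sumr -big_split /=.
apply: eq_bigr => i _; rewrite mderivM rmorphD !rmorphM scalerDr.
by rewrite scalerAl scalerAr.
Qed.
End Lines.

Lemma horner_along (n : nat) (K : comNzRingType) (u y : 'I_n -> K) p c :
  (along idfun u y p).[c] = p.@[fun i => u i + y i * c].
Proof.
elim/mpoly_ring_ind: p => [a|i|p q IHp IHq|p q IHp IHq].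
- by rewrite alongC hornerC mevalC.
- by rewrite alongX !hornerE mevalXU.
- by rewrite rmorphD hornerD mevalD IHp IHq.
by rewrite rmorphM hornerM mevalM IHp IHq.
Qed.

(** * Points of nonvanishing, and division by a homogeneous polynomial *)

Section Nonvanishing.
Variables (n : nat) (K : numFieldType).
Implicit Types (p : {mpoly K[n]}).

Lemma poly_vanishing (q : {poly K}) : (forall c, q.[c] = 0) -> q = 0.
Proof.
move=> q0; apply/eqP; apply: contraT => qn0.
(* In characteristic 0 the numbers 0, ..., [size q] - 1 are distinct, which is one root too many. *)
have := @max_poly_roots _ q [seq k%:R | k <- iota 0 (size q)] qn0.
rewrite size_map size_iota ltnn; apply.
  by apply/allP => _ /mapP[k _ ->]; rewrite /root q0.
rewrite map_inj_uniq ?iota_uniq // => a b /eqP.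
by rewrite eqr_nat => /eqP.
Qed.

(** Induction on the degree: the partial derivatives also vanish everywhere and have smaller degree,
    so they are zero and [p] is the constant p(0) = 0. *)
Lemma meval_vanishing p : (forall v, p.@[v] = 0) -> p = 0.
Proof.
have [k] := ubnP (msize p); elim: k p => // k IH p; rewrite ltnS => pk p0.
have dp i : p^`M(i) = 0.
  have [->|dpn0] := eqVneq p^`M(i) 0; first by [].
  apply: IH.
    have mpos : (0 < msize p)%N.
      rewrite lt0n msize_poly_eq0; apply: contra_neq dpn0 => ->.
      by rewrite mderiv0.
    apply: leq_trans pk; rewrite -(prednK mpos) ltnS msizeE.
    apply/bigmax_leqP_seq => m; rewrite mcoeff_msupp mcoeff_deriv => pm _.
    have : (m + U_(i))%MM \in msupp p.
      by rewrite mcoeff_msupp; apply: contra_neq pm => ->; rewrite mul0rn.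
    by move/msize_mdeg_lt; rewrite mdegD mdeg1 addn1 => lt_m; rewrite -ltnS prednK.
  (* The derivative of [p] at [v] is read off the line through [v] in the direction of the i-th
     axis, on which [p] restricts to zero. *)
  move=> v; have /(congr1 (fun q => q^`().[0])) : along idfun v (fun j => (j == i)%:R) p = 0.
    by apply: poly_vanishing => c; rewrite horner_along.
  rewrite deriv0 horner0 deriv_along (bigD1 i) //= eqxx scale1r.
  rewrite big1 => [|j /negbTE->]; last by rewrite scale0r.
  rewrite addr0 horner_along => <-; apply: meval_eq => j.
  by rewrite mulr0 addr0.
have Ep := mderiv_eq0_const dp.
by have := p0 (fun=> 0); rewrite Ep mevalC => ->; rewrite mpolyC0.
Qed.
End Nonvanishing.

(** A formal leading coefficient: [c] may be 0, so that it is multiplicative in [d] and [c] over any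
    ring. *)
Definition top_coef (S : nzRingType) (d : nat) (c : S) (p : {poly S}) :=
  (size p <= d.+1)%N /\ p`_d = c.

Lemma top_coefM (S : nzRingType) d e (a b : S) p q :
  top_coef d a p -> top_coef e b q -> top_coef (d + e) (a * b) (p * q).
Proof.
move=> [sp <-] [sq <-]; split.
  apply: leq_trans (size_polyMleq _ _) _.
  by move: sp sq; lia.
have lt_d : (d < (d + e).+1)%N by rewrite ltnS leq_addr.
rewrite coefM (bigD1 (Ordinal lt_d)) //= addKn big1 ?addr0 // => -[i /= ile] ned.
have {}ned : i != d by apply: contra_neq ned => ei; apply: val_inj.
case: (ltnP i d) => id; last first.
  by rewrite (nth_default _ (_ : size p <= i)%N) ?mul0r //; move: sp ned id; lia.
rewrite (nth_default _ (_ : size q <= d + e - i)%N) ?mulr0 //.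
by move: sq ile id; lia.
Qed.

Lemma top_coef_exp (S : nzRingType) d (a : S) p k :
  top_coef d a p -> top_coef (k * d) (a ^+ k) (p ^+ k).
Proof.
move=> ap; elim: k => [|k IH]; last by rewrite mulSn !exprS; apply: top_coefM.
by rewrite !expr0 mul0n; split; rewrite ?size_poly1 // coef1.
Qed.

(** In each monomial the base point [u] contributes only to lower powers of ['X]; the top power sees
    only the direction [y]. *)
Lemma top_coef_along (n : nat) (K S : comNzRingType) (f : {rmorphism K -> S})
    (u y : 'I_n -> S) d (p : {mpoly K[n]}) :
  p \is d.-homog -> top_coef d (mmap f y p) (along f u y p).
Proof.
move=> ph; have Tm m : m \in msupp p ->
    top_coef d (f p@_m * mmap1 y m)
      ((polyC \o f) p@_m * mmap1 (fun i => (u i)%:P + y i *: 'X) m).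
  move=> mp; rewrite -[d]add0n; apply: top_coefM => /=.
    by split; [apply: leq_trans (size_polyC_leq1 _) _|rewrite coefC].
  have <- : mdeg m = d := dhomog_mf ph mp.
  rewrite mdegE /mmap1.
  elim/big_rec3: _ => [|i a k b _ IH]; first by split; rewrite ?size_poly1 ?coef1.
  apply: top_coefM => //; rewrite -[X in top_coef X]muln1; apply: top_coef_exp.
  split; last by rewrite coefD coefC coefZ coefX mulr1 add0r.
  apply: leq_trans (size_polyD _ _) _; rewrite geq_max.
  rewrite (leq_trans (size_polyC_leq1 _)) //.
  by rewrite (leq_trans (size_scale_leq _ _)) // size_polyX.
split.
  apply: leq_trans (size_sum _ _ _) _; apply/bigmax_leqP_seq => m mp _.
  by have [] := Tm m mp.
rewrite coef_sum /mmap; apply: eq_big_seq => m mp.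
by have [] := Tm m mp.
Qed.

Lemma along0 (n : nat) (K : comNzRingType) (y : 'I_n -> {mpoly K[n]}) p :
  (along (@mpolyC n K) (fun i => 'X_i) y p).[0] = p.
Proof.
elim/mpoly_ring_ind: p => [a|i|p q IHp IHq|p q IHp IHq].
- by rewrite alongC hornerC.
- by rewrite alongX !hornerE.
- by rewrite alongD hornerD; exact: (f_equal2 +%R IHp IHq).
by rewrite alongM hornerM; exact: (f_equal2 *%R IHp IHq).
Qed.

(* The translate of a homogeneous polynomial along a direction where it does not
   vanish has a constant leading coefficient in the new variable, so divisibility
   can be tested by univariate division. *)
Lemma homog_dvd_exp (n : nat) (K : numFieldType) (A B H : {mpoly K[n]}) b m :
  (0 < m)%N -> B != 0 -> B \is b.-homog -> A ^+ m = H * B ^+ m ->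
  exists Q, A = Q * B.
Proof.
move=> m0 B0 Bh AB; have [y By] : exists y, B.@[y] != 0.
  apply: contrapT => /forallNP nB; move/eqP: B0; apply; apply: meval_vanishing.
  by move=> v; have /negP := nB v; rewrite negbK => /eqP.
pose phi := along (@mpolyC n K) (fun i => 'X_i) (fun i => (y i)%:MP).
have [sB cB] : top_coef b (B.@[y])%:MP (phi B).
  have -> : (B.@[y])%:MP = mmap (@mpolyC n K) (fun i => (y i)%:MP_[n]) B.
    rewrite mevalE /mmap rmorph_sum; apply: eq_bigr => k _.
    rewrite rmorphM rmorph_prod; congr (_ * _); apply: eq_bigr => i _.
    by rewrite rmorphXn.
  exact: top_coef_along.
have phiM p q : phi (p * q) = phi p * phi q by exact: alongM.
have phiX p k : phi (p ^+ k) = phi p ^+ k by exact: alongXn.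
have phi0 p : (phi p).[0] = p by exact: along0.
(* Left transparent, [phi] gets unfolded whenever two of its values are compared. *)
clearbody phi.
have sB' : size (phi B) = b.+1.
  apply/eqP; rewrite eqn_leq sB ltnNge; apply: contraNN By => /leq_sizeP/(_ b).
  by rewrite leqnn cB => /(_ isT)/eqP; rewrite mpolyC_eq0.
have uB : lead_coef (phi B) \is a GRing.unit.
  rewrite lead_coefE sB' cB; apply/unitrP; exists ((B.@[y])^-1)%:MP.
  by rewrite -!mpolyCM mulVf // mulfV.
(* Over an integral domain [%|] is pseudo-divisibility, that is, divisibility over the field of
   fractions, where m-th powers can be cancelled. The unit leading coefficient of [phi B] turns it
   into an exact quotient, and 0 is then substituted for the new variable. *)
have dv : (phi B %| phi A)%R.
  by rewrite -(dvdp_pexp2r (phi B) (phi A) m0) -!phiX AB phiM dvdp_mull.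
exists (phi A %/ phi B).[0].
have /(congr1 (fun q => q.[0])) := Pdiv.IdomainUnit.divpK uB dv.
by rewrite hornerM !phi0.
Qed.

(** * Euler's identity and polynomials with proportional logarithmic derivatives *)

Section EulerOperators.
Variables (n : nat) (K : numFieldType).
Implicit Types (p U V W : {mpoly K[n]}) (i : 'I_n).

Lemma mcoeff_mulX_deriv p i m : ('X_i * p^`M(i))@_m = (m i)%:R * p@_m.
Proof.
elim/mpolyind: p => [|c k p _ _ IH]; first by rewrite mderiv0 mulr0 !mcoeff0 mulr0.
rewrite mderivD mulrDr !mcoeffD IH mulrDr; congr (_ + _).
rewrite mderivZ mderivX -!scalerAr !mcoeffZ -mpolyXD.
have [ki0|ki] := posnP (k i).
  rewrite ki0 mul0r mulr0 mcoeffX; have [<-|_] := eqVneq k m; rewrite ?mulr0 //.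
  by rewrite ki0 mul0r.
have -> : (U_(i) + (k - U_(i)))%MM = k.
  rewrite addmC submK //; apply/mnm_lepP => j.
  by rewrite mnm1E; case: eqP => // <-.
rewrite mcoeffX; have [<-|_] := eqVneq k m; last by rewrite !mulr0.
by rewrite !mulr1 mulrC.
Qed.

Lemma euler_homog p d : p \is d.-homog -> \sum_i 'X_i * p^`M(i) = d%:R *: p.
Proof.
move=> ph; apply/mpolyP => m; rewrite raddf_sum mcoeffZ /=.
under eq_bigr do rewrite mcoeff_mulX_deriv.
rewrite -mulr_suml -natr_sum -mdegE.
have [->|md] := eqVneq (mdeg m) d; first by [].
by rewrite (dhomog_nemf_coeff ph md) !mulr0.
Qed.

(** The extra factor [p] avoids the exponent k - 1. *)
Lemma mderivXn p k i : p * (p ^+ k)^`M(i) = k%:R *: (p ^+ k * p^`M(i)).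
Proof.
elim: k => [|k IH]; first by rewrite expr0 -mpolyC1 mderivC mulr0 scale0r.
rewrite exprS mderivM mulrDr [p * (p * _)]mulrCA [p * (_ * _)]mulrCA IH.
rewrite -addn1 natrD scalerDl scale1r addrC -scalerAr.
by rewrite !mulrA [p^`M(i) * p]mulrC -!mulrA [p^`M(i) * _]mulrC.
Qed.

(** The Euler operator shifted by the identity: its eigenvalue m_i + 1 on the monomial m is never 0,
    so it preserves supports and leading monomials. *)
Let theta i p := 'X_i * p^`M(i) + p.

Let coef_theta i p m : (theta i p)@_m = ((m i).+1)%:R * p@_m.
Proof. by rewrite mcoeffD mcoeff_mulX_deriv -[in RHS]addn1 natrD mulrDl mul1r. Qed.

Let theta_neq0 i p : p != 0 -> theta i p != 0.
Proof.
move=> p0; apply/eqP => /(congr1 (fun q => q@_(mlead p))) /eqP.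
by rewrite mcoeff0 coef_theta mulf_eq0 mleadc_eq0 (negbTE p0) pnatr_eq0.
Qed.

Let mlead_theta i p : p != 0 -> mlead (theta i p) = mlead p.
Proof.
move=> p0; apply: le_anti; apply/andP; split; apply: msupp_le_mlead.
  have := mlead_supp (theta_neq0 i p0).
  by rewrite !mcoeff_msupp coef_theta mulf_eq0 negb_or => /andP[].
by rewrite mcoeff_msupp coef_theta mulf_eq0 mleadc_eq0 (negbTE p0) pnatr_eq0.
Qed.

(** The relation gives theta(U) V = theta(V) U; comparing leading coefficients shows that the
    eigenvalues of [theta i] at the two leading monomials agree, for every i. *)
Lemma mlead_wronskian U V :
  U != 0 -> V != 0 -> (forall i, V * U^`M(i) = U * V^`M(i)) -> mlead U = mlead V.
Proof.
move=> U0 V0 UV; apply/mnmP => i.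
have E : theta i U * V = theta i V * U.
  rewrite /theta !mulrDl [V * U]mulrC; congr (_ + _).
  by rewrite -!mulrA [_ * V]mulrC [_ * U]mulrC UV.
have /(congr1 (fun q => mleadc q)) := E.
rewrite !mleadM ?theta_neq0 // !mleadcM !mlead_theta // !coef_theta => /eqP.
rewrite -!mulrA [U@__ * _]mulrC -subr_eq0 -mulrBl mulf_eq0 mulf_eq0 !mleadc_eq0.
by rewrite (negbTE U0) (negbTE V0) !orbF subr_eq0 eqr_nat eqSS => /eqP.
Qed.

(** With [c] the quotient of the leading coefficients, U - cV satisfies the same relation. If it
    were nonzero, its leading monomial would be that of V, where its coefficient is 0. *)
Lemma wronskian_proportional U V :
  V != 0 -> (forall i, V * U^`M(i) = U * V^`M(i)) -> exists c, U = c *: V.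
Proof.
move=> V0 UV; have [->|U0] := eqVneq U 0; first by exists 0; rewrite scale0r.
pose c := mleadc U / mleadc V; exists c; apply/eqP; rewrite -subr_eq0.
apply/negPn/negP => W0.
have WV := @mlead_wronskian (U - c *: V) V W0 V0.
have := mleadc_eq0 (U - c *: V); rewrite {}WV.
  rewrite mcoeffB mcoeffZ -(mlead_wronskian U0 V0 UV) {2}(mlead_wronskian U0 V0 UV).
  by rewrite divfK ?mleadc_eq0 // subrr eqxx (negbTE W0).
by move=> i; rewrite mderivB mderivZ mulrBr mulrBl UV -scalerAr -scalerAl.
Qed.

End EulerOperators.

(** Euler's identity turns dh /\ dQ = 0 into t h dQ = q Q dh, so Q^t' = c h^q' with t' = t/g and q'
    = q/g coprime. If t' > 1, Bezout's identity makes h, up to a constant, the t'-th power of the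
    fraction h^u / Q^a, which is a polynomial; this contradicts the hypothesis on h. *)
Lemma homog_dependent (n : nat) (K : numClosedFieldType) (h Q : {mpoly K[n]}) t q :
  (0 < t)%N -> h != 0 -> h \is t.-homog -> Q != 0 -> Q \is q.-homog ->
  (forall p k, (1 < k)%N -> h <> p ^+ k) ->
  (forall i j, h^`M(i) * Q^`M(j) = h^`M(j) * Q^`M(i)) ->
  (t %| q)%N /\ exists c, Q = c *: h ^+ (q %/ t).
Proof.
move=> t0 h0 hh Q0 Qh hpow dd; set g := gcdn t q.
have g0 : (0 < g)%N by rewrite gcdn_gt0 t0.
pose t' := (t %/ g)%N; pose q' := (q %/ g)%N.
have Et : t = (t' * g)%N by rewrite divnK ?dvdn_gcdl.
have Eq : q = (q' * g)%N by rewrite divnK ?dvdn_gcdr.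
have t'0 : (0 < t')%N by move: t0; rewrite Et muln_gt0 => /andP[].
have cop : coprime t' q'.
  by rewrite /coprime -(eqn_pmul2r g0) muln_gcdl -Et -Eq mul1n.
(* Expand t h as the sum of the x_j dh/dx_j, exchange the roles of h and Q in each product of
   derivatives, and recognize q Q. *)
have ratio i : t'%:R *: (h * Q^`M(i)) = q'%:R *: (Q * h^`M(i)).
  have : t%:R *: (h * Q^`M(i)) = q%:R *: (Q * h^`M(i)).
    rewrite 2!scalerAl -(euler_homog hh) -(euler_homog Qh) !mulr_suml.
    apply: eq_bigr => j _; rewrite -!mulrA; congr (_ * _).
    by rewrite dd mulrC.
  rewrite Et Eq ![(_ * g)%N]mulnC !natrM -!scalerA.
  by apply: scalerI; rewrite pnatr_eq0 -lt0n.
have [c Ec] : exists c, Q ^+ t' = c *: h ^+ q'.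
  apply: wronskian_proportional => [|i]; first exact: expf_neq0.
  have hQ0 : h * Q != 0 by rewrite mulf_neq0.
  apply: (mulfI hQ0).
  have -> : h * Q * (h ^+ q' * (Q ^+ t')^`M(i)) =
     h ^+ q' * Q ^+ t' * (t'%:R *: (h * Q^`M(i))).
    have -> : h * Q * (h ^+ q' * (Q ^+ t')^`M(i)) =
       h * h ^+ q' * (Q * (Q ^+ t')^`M(i)) by ring.
    by rewrite mderivXn -!scalerAr; congr (_ *: _); ring.
  rewrite ratio.
  have -> : h * Q * (Q ^+ t' * (h ^+ q')^`M(i)) =
     Q * Q ^+ t' * (h * (h ^+ q')^`M(i)) by ring.
  by rewrite mderivXn -!scalerAr; congr (_ *: _); ring.
have c0 : c != 0.
  apply: contra_neq (expf_neq0 t' Q0) => c0.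
  by rewrite Ec c0 scale0r.
have [t1|t1] := leqP t' 1.
  have t'1 : t' = 1%N by apply/eqP; rewrite eqn_leq t1.
  have Eg : g = t by rewrite Et t'1 mul1n.
  split; first by rewrite -Eg dvdn_gcdr.
  by exists c; rewrite -[X in (q %/ X)%N]Eg -Ec t'1 expr1.
(* Here 1 + a q' = u t'. *)
have [a _] := Bezoutl q' t'0; rewrite (eqP cop) => /dvdnP[u Eu].
have EA : (h ^+ u) ^+ t' = c ^- a *: h * (Q ^+ a) ^+ t'.
  rewrite -!exprM -Eu [(a * t')%N]mulnC [in RHS]exprM Ec exprZn -exprM -scalerAr -scalerAl.
  by rewrite scalerA divff ?expf_neq0 // scale1r exprS [(a * _)%N]mulnC.
have [P EP] := homog_dvd_exp t'0 (expf_neq0 a Q0) (dhomogMn a Qh) EA.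
have : P ^+ t' = c ^- a *: h.
  apply: (mulIf (expf_neq0 t' (expf_neq0 a Q0))).
  by rewrite -EA EP exprMn.
(* The constant is absorbed by a t'-th root, as the field is algebraically closed. *)
move=> Eh; case: (hpow (t'.-root (c ^+ a) *: P) t' t1).
by rewrite exprZn rootCK // Eh scalerA divff ?expf_neq0 // scale1r.
Qed.

(** * Extension of a derivation to the field of fractions *)

Lemma fraction_surj (A : idomainType) (x : {fraction A}) :
  exists2 u : A * A, u.2 != 0 & x = u.1%:F / u.2%:F.
Proof.
elim/quotW: x => f; exists (frac f); first exact: denom_ratioP.
have d0 := denom_ratioP f; apply: (mulIf (_ : _.2%:F != 0)); first by rewrite tofrac_eq0; exact: d0.
rewrite divfK ?tofrac_eq0 //; unlock FracField.tofrac; rewrite -[LHS]FracField.pi_mul.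
apply/eqmodP; rewrite /= FracField.equivfE /FracField.mulf /=.
by rewrite !numden_Ratio ?mulr1 ?oner_neq0 // mulrC.
Qed.

Section FractionDerivation.
Variables (A : idomainType) (D : {additive A -> A}).
Hypothesis DM : forall p q, D (p * q) = D p * q + p * D q.
Implicit Types (x y : {fraction A}) (a b : A).

(** The quotient rule on a chosen representative; [fder_div] shows that it gives the same value on
    every other one. *)
Definition fder x : {fraction A} :=
  let u := sval (cid2 (fraction_surj x)) in
  (D u.1 * u.2 - u.1 * D u.2)%:F / (u.2 ^+ 2)%:F.

Lemma fder_div a b :
  b != 0 -> fder (a%:F / b%:F) = (D a * b - a * D b)%:F / (b ^+ 2)%:F.
Proof.
move=> b0; rewrite /fder; case: cid2 => -[p q] /= q0 /eqP.
rewrite eqr_div ?tofrac_eq0 // -!tofracM tofrac_eq => /eqP E.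
apply/eqP; rewrite eqr_div ?tofrac_eq0 ?expf_neq0 // -!tofracM tofrac_eq.
have := congr1 D E; rewrite !DM => DE; rewrite -subr_eq0.
(* The difference of the cross products is a combination of the relation between the two
   representatives and its derivative. *)
have -> : (D p * q - p * D q) * b ^+ 2 - (D a * b - a * D b) * q ^+ 2 =
    b * q * (D p * b + p * D b - (D a * q + a * D q))
    + (b * D q + q * D b) * (a * q - p * b) by ring.
by rewrite DE E !subrr !mulr0 addr0.
Qed.

Lemma fder_tofrac a : fder a%:F = (D a)%:F.
Proof.
have D1 : D 1 = 0.
  by apply: (addrI (D 1)); have := DM 1 1; rewrite !mulr1 mul1r addr0 => <-.
have := fder_div a (oner_neq0 A); rewrite tofrac1 divr1 => ->.
by rewrite expr1n tofrac1 divr1 mulr1 D1 mulr0 subr0.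
Qed.

Lemma fderD x y : fder (x + y) = fder x + fder y.
Proof.
have [[a b] /= b0 ->] := fraction_surj x; have [[c d] /= d0 ->] := fraction_surj y.
rewrite addf_div ?tofrac_eq0 // -!tofracM -tofracD !fder_div ?mulf_neq0 //.
rewrite addf_div ?tofrac_eq0 ?expf_neq0 // -!tofracM -tofracD -exprMn.
by congr (_%:F / _); rewrite raddfD /= !DM; ring.
Qed.

Lemma fderM x y : fder (x * y) = fder x * y + x * fder y.
Proof.
have [[a b] /= b0 ->] := fraction_surj x; have [[c d] /= d0 ->] := fraction_surj y.
rewrite mulf_div -!tofracM !fder_div ?mulf_neq0 // !mulf_div.
rewrite addf_div ?mulf_neq0 ?tofrac_eq0 ?expf_neq0 // -!tofracM -tofracD.
apply/eqP; rewrite eqr_div ?tofrac_eq0 ?mulf_neq0 ?expf_neq0 ?mulf_neq0 //.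
by rewrite -!tofracM tofrac_eq !DM; apply/eqP; ring.
Qed.

Lemma fder0 : fder 0 = 0.
Proof. by rewrite -tofrac0 fder_tofrac raddf0. Qed.

Lemma fderB x y : fder (x - y) = fder x - fder y.
Proof. by apply: (addIr (fder y)); rewrite -fderD !subrK. Qed.

Lemma fder_sum I (r : seq I) (f : I -> {fraction A}) :
  fder (\sum_(i <- r) f i) = \sum_(i <- r) fder (f i).
Proof. exact: (big_morph fder fderD fder0). Qed.

Lemma fder1 : fder 1 = 0.
Proof. by apply: (addrI (fder 1)); have := fderM 1 1; rewrite !mulr1 mul1r addr0 => <-. Qed.

Lemma fderXn x k : fder (x ^+ k) = k%:R * x ^+ k.-1 * fder x.
Proof.
elim: k => [|k IH]; first by rewrite fder1 !mul0r.
rewrite exprS fderM IH /=; case: k {IH} => [|k] /=.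
  by rewrite expr0 !mul0r mulr0 addr0 mulr1 !mul1r.
by rewrite -[in RHS]natr1 exprS; ring.
Qed.

Lemma fderXz x (m : int) : x != 0 -> fder (x ^ m) = m%:~R * x ^ (m - 1) * fder x.
Proof.
move=> x0; case: m => k.
  rewrite -exprnP fderXn; case: k => [|k]; first by rewrite !mul0r.
  by have -> : Posz k.+1 - 1 = Posz k by lia.
have xk0 : x ^+ k.+1 != 0 by rewrite expf_neq0.
(* Negative powers: differentiate x^(-(k+1)) x^(k+1) = 1. *)
have : fder (x ^ Negz k * x ^+ k.+1) = 0.
  by rewrite -[x ^ Negz k]/(x ^- k.+1) mulVf // fder1.
rewrite fderM fderXn => /eqP; rewrite addr_eq0 => /eqP E.
apply: (mulIf xk0); rewrite {}E.
have -> : Negz k - 1 = Negz k.+1 by lia.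
rewrite -[x ^ Negz k]/(x ^- k.+1) -[x ^ Negz k.+1]/(x ^- k.+2).
rewrite NegzE mulrNz -pmulrn ![x ^+ _.+1]exprS -natr1 /=.
by field; rewrite x0 expf_neq0.
Qed.

Lemma fder_prod (I : finType) (f : I -> {fraction A}) :
  fder (\prod_i f i) = \sum_i fder (f i) * \prod_(j | j != i) f j.
Proof.
elim: (index_enum I) (index_enum_uniq I) => [|i s IH] /=.
  by rewrite !big_nil fder1.
move=> /andP[is_ us]; rewrite !big_cons fderM IH // eqxx /= mulr_sumr.
congr (_ + _).
  congr (_ * _); rewrite big_seq [RHS]big_seq_cond; apply: eq_bigl => j.
  by case js: (j \in s) => //=; apply/esym; apply: contraNneq is_ => <-.
rewrite big_seq [RHS]big_seq; apply: eq_bigr => j js; rewrite big_cons.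
by rewrite ifT ?[f i * _]mulrCA //; apply: contraNneq is_ => ->.
Qed.
End FractionDerivation.

(** * Exponents, their shifts, and the coefficients of the expansion *)

Section Exponents.
Variables (s t : nat).
Implicit Types (alpha beta : exponent s) (l : 'I_s).

(** The set [admissible] for d = s + 1 with integer bounds: differentiating lowers both the weight
    and the level bound, possibly below 0. *)
Definition exponents (M w : int) : set (exponent s) :=
  [set alpha | weight t alpha = w /\ level s.+1 t alpha <= M].

Definition incr l alpha : exponent s :=
  (alpha.1, [ffun k => (alpha.2 k + (k == l))%N]).
Definition decr l alpha : exponent s :=
  (alpha.1, [ffun k => (alpha.2 k - (k == l))%N]).
Definition addh (k : int) alpha : exponent s := (alpha.1 + k, alpha.2).

(** Since l + 1 <= s + 1 for l <= s, the weight plus the tail sum is at most the level. Hence every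
    tail entry is at most M - w, and the tail and the weight determine alpha_0. *)
Lemma exponents_finite M w : (0 < t)%N -> finite_set (exponents M w).
Proof.
move=> t0; pose m := `|M - w|%N.
pose g (f : {ffun 'I_s -> 'I_m.+1}) : exponent s :=
  (divz (w - (\sum_(l < s) l.+1 * f l)%N%:Z) t%:Z, [ffun l => nat_of_ord (f l)]).
apply: (@sub_finite_set _ _ (g @` setT)); last exact/finite_image/finite_finset.
move=> [a0 al]; rewrite /exponents /weight /level /tail_sum /= => -[Hw Hl].
set S := (\sum_(l < s) al l)%N in Hl; set W := (\sum_(l < s) l.+1 * al l)%N in Hw.
have Hsum : (W + S <= s.+1 * S)%N.
  rewrite /W /S big_distrr -big_split /=; apply: leq_sum => l _.
  by rewrite -mulSnr leq_mul2r ltnS ltn_ord orbT.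
have Hb l : (al l < m.+1)%N.
  have : (al l <= S)%N by rewrite /S (bigD1 l) //= leq_addr.
  by rewrite /m; move: Hw Hl Hsum; clearbody S W; lia.
exists [ffun l => Ordinal (Hb l)] => //; rewrite /g; congr pair.
  under eq_bigr do rewrite ffunE /=.
  by rewrite -/W -Hw addrK mulrC mulzK //; lia.
by apply/ffunP => l; rewrite !ffunE.
Qed.

Lemma decr_incr l : cancel (incr l) (decr l).
Proof.
by move=> [a0 al]; congr pair; apply/ffunP => k; rewrite !ffunE addnK.
Qed.

Lemma incr_decr l alpha : (0 < alpha.2 l)%N -> incr l (decr l alpha) = alpha.
Proof.
case: alpha => a0 al /= al0; congr pair; apply/ffunP => k.
by rewrite !ffunE; case: eqP => [->|_]; [rewrite subnK|rewrite subn0 addn0].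
Qed.

Lemma sum_delta (f : 'I_s -> nat) l : (\sum_(k < s) f k * (k == l))%N = f l.
Proof.
rewrite (bigD1 l) //= eqxx muln1 big1 ?addn0 // => k /negbTE->.
by rewrite muln0.
Qed.

Lemma tail_sum_incr l alpha : tail_sum (incr l alpha) = (tail_sum alpha).+1.
Proof.
rewrite /tail_sum /=; under eq_bigr do rewrite ffunE -[X in (_ + X)%N]mul1n.
by rewrite big_split /= (sum_delta (fun=> 1%N)) addn1.
Qed.

Lemma weight_incr l alpha : weight t (incr l alpha) = weight t alpha + l.+1%:Z.
Proof.
rewrite /weight /=; under eq_bigr do rewrite ffunE mulnDr.
by rewrite big_split /= (sum_delta (fun l => l.+1)) PoszD addrA.
Qed.

Lemma level_incr l alpha :
  level s.+1 t (incr l alpha) = level s.+1 t alpha + s.+1%:Z.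
Proof. by rewrite /level tail_sum_incr mulnS /=; lia. Qed.

Lemma incr_exponents M w l alpha :
  exponents (M - s.+1%:Z) (w - l.+1%:Z) alpha <-> exponents M w (incr l alpha).
Proof. by rewrite /exponents /= weight_incr level_incr; split=> -[? ?]; lia. Qed.

Lemma addh_exponents M w r alpha : (t * r = s.+1)%N ->
  exponents (M - s.+1%:Z) (w - s.+1%:Z) (addh (- r%:Z) alpha) <-> exponents M w alpha.
Proof.
move=> tr; rewrite /exponents /weight /level /addh /tail_sum /= mulrDr mulrN -PoszM tr.
by split=> -[? ?]; lia.
Qed.

Section Coefficients.
Variables (K : numFieldType) (r : nat) (a : int -> K).

(* The coefficient [c_(beta + e_l) (beta_l + 1)] of [F^beta h^beta_0] in dS/dF_l,
   which is independent of l. *)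
Definition dcoef beta : K :=
  (\prod_(1 <= k < (tail_sum beta).+2) (beta.1%:~R + (r * k)%:R))
  / (\prod_(l < s) \prod_(1 <= m < (beta.2 l).+1) (r * m)%:R) / r%:R
  * a (level s.+1 t beta + s.+1%:Z).

(** Passing to beta + e_l adds the factor r (beta_l + 1) to the denominator, and after
    multiplication by beta_l + 1 only 1/r remains, whatever l is. *)
Lemma coefc_incr l beta : (0 < r)%N ->
  coefc s.+1 t r a (incr l beta) * (beta.2 l).+1%:R = dcoef beta.
Proof.
move=> r0; rewrite /coefc /dcoef level_incr tail_sum_incr.
set P := \prod_(1 <= k < _) _; set A := a _.
set X := \prod_(k < s) _; set Y := \prod_(k < s) _.
have EX : X = Y * (r * (beta.2 l).+1)%:R.
  rewrite /X /Y (bigD1 l) //= [in RHS](bigD1 l) //= ffunE eqxx addn1.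
  rewrite big_nat_recr //= mulrAC; congr (_ * _ * _).
  by apply: eq_bigr => k /negbTE kl; rewrite ffunE kl addn0.
have Y0 : Y != 0.
  apply/prodf_neq0 => k _; rewrite prodf_seq_neq0; apply/allP => m.
  by rewrite mem_index_iota pnatr_eq0 muln_eq0 negb_or -!lt0n r0 => /andP[->].
have b0 : (beta.2 l).+1%:R != 0 :> K by rewrite pnatr_eq0.
have rn0 : r%:R != 0 :> K by rewrite pnatr_eq0 -lt0n.
rewrite EX natrM; move: (_.+1%:R) b0 (r%:R) rn0 => b b0 c c0; clearbody P X Y A.
by field; rewrite Y0 b0 c0.
Qed.

(** The counterpart of [coefc_incr] for the top component h^r: lowering alpha_0 by r shifts the
    index of the factors alpha_0 + r k by one, which brings in the factor alpha_0 for k = 0, and the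
    level shifts by t r = d. *)
Lemma dcoef_addh alpha : (0 < r)%N -> (t * r = s.+1)%N ->
  dcoef (addh (- r%:Z) alpha) * r%:R = coefc s.+1 t r a alpha * alpha.1%:~R.
Proof.
move=> r0 tr; rewrite /coefc /dcoef /=.
have -> : tail_sum (addh (- r%:Z) alpha) = tail_sum alpha by [].
have -> : level s.+1 t (addh (- r%:Z) alpha) + s.+1%:Z = level s.+1 t alpha.
  by rewrite /level /addh /tail_sum /= mulrDr mulrN -PoszM tr; lia.
rewrite big_nat_recl // muln1.
have -> : (alpha.1 - r%:Z)%:~R + r%:R = alpha.1%:~R :> K.
  by rewrite rmorphB /= subrK.
rewrite (eq_big_nat _ _ (F2 := fun k => alpha.1%:~R + (r * k)%:R)); last first.
  by move=> k _; rewrite rmorphB /= mulnS natrD addrA subrK.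
rewrite [X in X * r%:R]mulrAC divfK ?pnatr_eq0 -?lt0n //.
by rewrite -!mulrA mulrC -!mulrA.
Qed.

End Coefficients.
End Exponents.

(** * Partial derivatives of rational functions *)

Section PartialDerivatives.
Variables (n : nat) (K : numFieldType) (i : 'I_n).
Local Notation L := {fraction {mpoly K[n]}}.

Definition pder : L -> L := fder (@mderiv n K i).

Lemma pder_tofrac p : pder p%:F = (p^`M(i))%:F.
Proof. exact: (fder_tofrac (mderivM i)). Qed.
Lemma pderB x y : pder (x - y) = pder x - pder y.
Proof. exact: (fderB (mderivM i)). Qed.
Lemma pderM x y : pder (x * y) = pder x * y + x * pder y.
Proof. exact: (fderM (mderivM i)). Qed.
Lemma pder_sum I (q : seq I) (f : I -> L) :
  pder (\sum_(k <- q) f k) = \sum_(k <- q) pder (f k).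
Proof. exact: (fder_sum (mderivM i)). Qed.
Lemma pderXn x k : pder (x ^+ k) = k%:R * x ^+ k.-1 * pder x.
Proof. exact: (fderXn (mderivM i)). Qed.
Lemma pderXz x (m : int) : x != 0 -> pder (x ^ m) = m%:~R * x ^ (m - 1) * pder x.
Proof. exact: (fderXz (mderivM i)). Qed.
Lemma pder_prod (I : finType) (f : I -> L) :
  pder (\prod_k f k) = \sum_k pder (f k) * \prod_(j | j != k) f j.
Proof. exact: (fder_prod (mderivM i)). Qed.
Lemma pder_cstM c x : pder ((c%:MP_[n])%:F * x) = (c%:MP_[n])%:F * pder x.
Proof. by rewrite pderM pder_tofrac mderivC tofrac0 mul0r add0r. Qed.

End PartialDerivatives.

Lemma tofrac_mpolyC_nat (n : nat) (K : numFieldType) k :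
  ((k%:R)%:MP_[n])%:F = k%:R :> {fraction {mpoly K[n]}}.
Proof. by rewrite (rmorph_nat (@mpolyC n K)) rmorph_nat. Qed.

Lemma tofrac_mpolyC_int (n : nat) (K : numFieldType) (k : int) :
  ((k%:~R)%:MP_[n])%:F = k%:~R :> {fraction {mpoly K[n]}}.
Proof. by rewrite (rmorph_int (@mpolyC n K)) rmorph_int. Qed.

(** * The differential of the expansion and its bracket identity *)

Section Expansions.
Variables (n : nat) (K : numFieldType) (s t r : nat).
Variables (F : nat -> {mpoly K[n]}) (h : {mpoly K[n]}) (M : int) (a : int -> K).
Hypotheses (h0 : h != 0) (t0 : (0 < t)%N) (tr : (t * r = s.+1)%N).
Hypothesis Ftop : F s.+1 = h ^+ r.
Implicit Types (alpha beta : exponent s) (l : 'I_s) (i : 'I_n) (w : int).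
Local Notation L := {fraction {mpoly K[n]}}.
Local Notation cst c := ((c%:MP_[n])%:F : L).

(* [S_w] and [T_w] in the notation of the header, with [M] in place of [N]. *)
Definition expansion w : L :=
  \sum_(alpha \in @exponents s t M w) cst (coefc s.+1 t r a alpha) * monom F h alpha.

Definition dexpansion w : L :=
  \sum_(beta \in @exponents s t (M - s.+1%:Z) w) cst (dcoef t r a beta) * monom F h beta.

Let r0 : (0 < r)%N. Proof. by move: tr; case: r => //; rewrite muln0. Qed.
Let hF0 : h%:F != 0. Proof. by rewrite tofrac_eq0. Qed.

Lemma monom_addh alpha k : monom F h (addh k alpha) = monom F h alpha * h%:F ^ k.
Proof. by rewrite /monom expfzDr // mulrA. Qed.

Lemma pder_monom i alpha :
  pder i (monom F h alpha) =
    \sum_(l < s) (alpha.2 l)%:R * monom F h (decr l alpha) * ((F l.+1)^`M(i))%:F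
    + alpha.1%:~R * monom F h (addh (- 1) alpha) * (h^`M(i))%:F.
Proof.
rewrite {1}/monom pderM pderXz // pder_tofrac.
congr (_ + _); last by rewrite /monom /=; ring.
rewrite pder_prod mulr_suml; apply: eq_bigr => l _.
rewrite pderXn pder_tofrac /monom /= [in RHS](bigD1 l) //= ffunE eqxx subn1.
under [in RHS]eq_bigr => k /negbTE kl do rewrite ffunE kl subn0.
by ring.
Qed.

Lemma pder_expansion i w :
  pder i (expansion w) =
    \sum_(l < s.+1) dexpansion (w - l.+1%:Z) * ((F l.+1)^`M(i))%:F.
Proof.
have fin M' w' : finite_set (@exponents s t M' w') by exact: exponents_finite.
have -> : pder i (expansion w) =
    \sum_(l < s) (\sum_(alpha \in @exponents s t M w)
        cst (coefc s.+1 t r a alpha) * (alpha.2 l)%:R * monom F h (decr l alpha))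
      * ((F l.+1)^`M(i))%:F
    + (\sum_(alpha \in @exponents s t M w)
        cst (coefc s.+1 t r a alpha) * alpha.1%:~R * monom F h (addh (- 1) alpha))
      * (h^`M(i))%:F.
  rewrite /expansion !fsbig_finite // pder_sum.
  rewrite (eq_bigr (fun alpha => \sum_(l < s) cst (coefc s.+1 t r a alpha) *
      ((alpha.2 l)%:R * monom F h (decr l alpha) * ((F l.+1)^`M(i))%:F)
      + cst (coefc s.+1 t r a alpha) *
        (alpha.1%:~R * monom F h (addh (- 1) alpha) * (h^`M(i))%:F))); last first.
    move=> alpha _; rewrite (pder_cstM i (coefc s.+1 t r a alpha)) pder_monom.
    by rewrite mulrDr mulr_sumr.
  rewrite big_split /= exchange_big /= mulr_suml; congr (_ + _).
    apply: eq_bigr => l _; rewrite fsbig_finite // mulr_suml.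
    by apply: eq_bigr => alpha _; rewrite !mulrA.
  by apply: eq_bigr => alpha _; rewrite !mulrA.
rewrite big_ord_recr /=; congr (_ + _).
  apply: eq_bigr => l _; congr (_ * _); rewrite /dexpansion.
  pose G alpha : L := cst (coefc s.+1 t r a alpha) * (alpha.2 l)%:R * monom F h (decr l alpha).
  (* Put alpha = beta + e_l; exponents not of this form have alpha_l = 0, and their terms vanish. *)
  transitivity (\sum_(beta \in @exponents s t (M - s.+1%:Z) (w - l.+1%:Z)) G (incr l beta)).
    have inj : set_inj (@exponents s t (M - s.+1%:Z) (w - l.+1%:Z)) (incr l).
      by move=> x y _ _; apply: (can_inj (decr_incr l)).
    apply: etrans (fsbig_image _ (incr l) G inj).
    apply/esym/fsbig_widen => [_ [beta /incr_exponents Hb <-]//|alpha [Ha nim]].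
    have [al0|al0] := posnP (alpha.2 l); first by rewrite /G /= al0 mulr0 mul0r.
    case: nim; exists (decr l alpha); last exact: incr_decr.
    by apply/incr_exponents; rewrite incr_decr.
  apply: eq_fsbigr => beta _; rewrite /G decr_incr; congr (_ * _).
  rewrite -(coefc_incr t a l beta r0) ffunE eqxx addn1.
  by move: (coefc _ _ _ _ _) => c; rewrite mpolyCM tofracM tofrac_mpolyC_nat.
rewrite Ftop /dexpansion.
have -> : (h ^+ r)^`M(i)%:F = (r%:R * h%:F ^ (r%:Z - 1)) * (h^`M(i))%:F :> L.
  by rewrite -(pder_tofrac i (h ^+ r)) tofracXn exprnP pderXz // pder_tofrac pmulrn.
rewrite mulrA; congr (_ * _); rewrite mulr_fsuml.
(* Here beta is alpha with alpha_0 lowered by r: h^(-r) from this shift times h^(r-1) from d(h^r) is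
   the h^(-1) in the derivative of h^alpha_0. *)
rewrite [RHS](reindex_fsbig (addh (- r%:Z)) (exponents t M w)).
  apply: eq_fsbigr => alpha _; rewrite !monom_addh.
  have -> : cst (coefc s.+1 t r a alpha) * alpha.1%:~R =
            cst (dcoef t r a (addh (- r%:Z) alpha)) * r%:R.
    have := dcoef_addh a alpha r0 tr.
    move: (coefc _ _ _ _ _) (dcoef _ _ _ _) => c e E.
    by rewrite -tofrac_mpolyC_int -tofrac_mpolyC_nat -!tofracM -!mpolyCM E.
  rewrite -!mulrA; congr (_ * _); rewrite mulrCA; congr (_ * _).
  rewrite mulrCA; congr (_ * _).
  by rewrite [RHS]mulrCA -expfzDr // addrA addNr sub0r.
split=> [alpha|x y _ _|beta Hb].
- by move/(addh_exponents _ _ _ tr).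
- by move: x y => [x0 x] [y0 y] [] /addIr -> ->.
exists (addh r%:Z beta); last by case: beta {Hb} => b0 b; rewrite /addh /= addrK.
apply/(addh_exponents _ _ _ tr); rewrite /addh /= addrK; case: beta Hb => //.
Qed.

(** After inserting [pder_expansion], both double sums carry the factor T_(w-k-l), symmetric in k
    and l, so exchanging the summations matches them. *)
Lemma expansion_bracket i j w :
  \sum_(k < s.+1) (((F k.+1)^`M(i))%:F * pder j (expansion (w - k.+1%:Z))
                  - ((F k.+1)^`M(j))%:F * pder i (expansion (w - k.+1%:Z))) = 0.
Proof.
rewrite big_split /= sumrN; apply/eqP; rewrite subr_eq0; apply/eqP.
under eq_bigr do rewrite pder_expansion mulr_sumr.
under [RHS]eq_bigr do rewrite pder_expansion mulr_sumr.
rewrite [RHS]exchange_big; apply: eq_bigr => k _; apply: eq_bigr => l _.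
have -> : w - l.+1%:Z - k.+1%:Z = w - k.+1%:Z - l.+1%:Z by lia.
by rewrite mulrC -mulrA [RHS]mulrCA.
Qed.

End Expansions.

(** * Homogeneous components of the Poisson bracket *)

Section BracketComponents.
Variables (n : nat) (K : numFieldType).
Implicit Types (p q : {mpoly K[n]}).

Lemma dhomog_mderiv p d i : p \is d.+1.-homog -> p^`M(i) \is d.-homog.
Proof.
move=> ph; apply/dhomogP => m; rewrite mcoeff_msupp mcoeff_deriv => pm.
have : (m + U_(i))%MM \in msupp p.
  by rewrite mcoeff_msupp; apply: contra_neq pm => ->; rewrite mul0rn.
move/(dhomog_mf ph) => E; have {}E : mdeg (m + U_(i))%MM = d.+1 by [].
by move: E; rewrite mdegD mdeg1 addn1 => -[].
Qed.

(** The sum is the component of degree s + e of [P], which the size bound kills. The components of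
    degrees k + 1 and l + 1 contribute in degree k + l, whence l = s - k + e; counting the two lost
    degrees, this is bracket degree d + (e + 1) for d = s + 1. *)
Lemma bracket_component s N (A B : nat -> {mpoly K[n]}) i j e :
  (forall k, (k <= s)%N -> A k.+1 \is k.+1.-homog) -> (forall l, B l.+1 \is l.+1.-homog) ->
  (forall l, (N <= l)%N -> B l.+1 = 0) ->
  let P := (\sum_(k < s.+1) A k.+1)^`M(i) * (\sum_(l < N) B l.+1)^`M(j)
         - (\sum_(k < s.+1) A k.+1)^`M(j) * (\sum_(l < N) B l.+1)^`M(i) in
  (msize P <= s + e)%N ->
  \sum_(k < s.+1) ((A k.+1)^`M(i) * (B (s - k + e).+1)^`M(j)
                 - (A k.+1)^`M(j) * (B (s - k + e).+1)^`M(i)) = 0.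
Proof.
move=> Ah Bh B0 P sP.
pose X k l := (A k.+1)^`M(i) * (B l.+1)^`M(j) - (A k.+1)^`M(j) * (B l.+1)^`M(i).
have Xh k l : (k <= s)%N -> X k l \is (k + l).-homog.
  by move=> ks; rewrite rpredB // dhomogM // dhomog_mderiv // Ah.
have PX : P = \sum_(k < s.+1) \sum_(l < N) X k l.
  rewrite /P !raddf_sum /= !big_distrlr /= -sumrB; apply: eq_bigr => k _.
  by rewrite -sumrB.
have : pihomog mdeg (s + e) P = 0.
  rewrite pihomogE big_seq_cond big_pred0 // => m; apply/negP => /andP[mP /eqP mE].
  by have := msize_mdeg_lt mP; rewrite ltnNge (leq_trans sP) // -mE.
rewrite PX raddf_sum /= => PE; rewrite -[RHS]PE; apply: eq_bigr => k _.
have ks : (k <= s)%N by rewrite -ltnS.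
rewrite -/(X k (s - k + e)%N) raddf_sum /=.
have Xpi l : pihomog mdeg (s + e) (X k l) = if l == (s - k + e)%N then X k l else 0.
  case: eqVneq => [->|ne].
    by rewrite pihomog_dE // (_ : s + e = k + (s - k + e))%N ?Xh // addnA subnKC.
  apply: (pihomog_ne0 _ (Xh k l ks)).
  by apply: contra_neq ne => E; move: E ks; clear; lia.
under eq_bigr do rewrite Xpi.
rewrite -big_mkcond /=; have [lt_l|ge_l] := ltnP (s - k + e) N.
  by rewrite (big_pred1 (Ordinal lt_l)) // => l; rewrite -val_eqE.
rewrite /X B0 // !mderiv0 !mulr0 subrr big1 // => l /eqP El.
by have := ltn_ord l; rewrite El ltnNge ge_l.
Qed.
End BracketComponents.

(** * Dependence of the expansion on the constants *)

Section ExpansionUpdate.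
Variables (n : nat) (K : numFieldType) (s t r : nat).
Variables (F : nat -> {mpoly K[n]}) (h : {mpoly K[n]}) (M : int).
Hypothesis t0 : (0 < t)%N.
Implicit Types (alpha : exponent s) (a : int -> K) (w : int) (c : K).
Local Notation L := {fraction {mpoly K[n]}}.
Local Notation cst c := ((c%:MP_[n])%:F : L).
Local Notation S a w := (@expansion n K s t r F h M a w).

Definition upd a w c : int -> K := fun k => if k == w then c else a k.

(** This makes the system triangular: S_w involves only the a_k with k >= w, and a_w only through
    exponents with zero tail. *)
Lemma weight_le_level alpha :
  weight t alpha + (tail_sum alpha)%:Z <= level s.+1 t alpha.
Proof.
rewrite /weight /level -addrA lerD2l -PoszD lez_nat /tail_sum big_distrr /=.
rewrite -big_split /=; apply: leq_sum => l _.
by rewrite -mulSnr leq_mul2r ltnS ltn_ord orbT.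
Qed.

Lemma coefc_upd a w c alpha : level s.+1 t alpha != w ->
  coefc s.+1 t r (upd a w c) alpha = coefc s.+1 t r a alpha.
Proof. by rewrite /coefc /upd => /negbTE ->. Qed.

Lemma expansion_upd_gt a w c w' : w < w' -> S (upd a w c) w' = S a w'.
Proof.
move=> ww'; apply: eq_fsbigr => alpha; rewrite inE => -[walpha _].
rewrite coefc_upd //; have := weight_le_level alpha.
by apply: contraTneq => ->; rewrite walpha; lia.
Qed.

Lemma expansion_gt a w : M < w -> S a w = 0.
Proof.
move=> Mw; apply: fsbig1 => alpha [walpha lalpha].
by have := weight_le_level alpha; rewrite walpha; lia.
Qed.

Lemma expansion_zero a w : (forall k, a k = 0) -> S a w = 0.
Proof.
by move=> a0; apply: fsbig1 => alpha _; rewrite /coefc a0 mulr0 mpolyC0 tofrac0 mul0r.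
Qed.

Lemma tail_sum_eq0 alpha : tail_sum alpha = 0%N -> alpha = (alpha.1, [ffun=> 0%N]).
Proof.
case: alpha => b al /= /eqP; rewrite sum_nat_eq0 => /forallP al0.
by congr pair; apply/ffunP => l; rewrite ffunE; apply/eqP/al0.
Qed.

(** The exponent (b, 0, ..., 0) has coefficient [c]; every other exponent of weight t b has a larger
    level and does not see the update. *)
Lemma expansion_upd_dvd a c (b : int) : t%:Z * b <= M ->
  S (upd a (t%:Z * b) c) (t%:Z * b) =
  S (upd a (t%:Z * b) 0) (t%:Z * b) + cst c * h%:F ^ b.
Proof.
move=> bM; pose alpha0 : exponent s := (b, [ffun=> 0%N]).
have ts0 : tail_sum alpha0 = 0%N.
  by rewrite /tail_sum big1 // => l _; rewrite ffunE.
have l0 : level s.+1 t alpha0 = t%:Z * b by rewrite /level ts0 muln0 addr0.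
have A0 : @exponents s t M (t%:Z * b) alpha0.
  split; last by rewrite l0.
  by rewrite /weight /= big1 ?addr0 // => l _; rewrite ffunE muln0.
have m0 : monom F h alpha0 = h%:F ^ b.
  by rewrite /monom big1 ?mul1r // => l _; rewrite ffunE expr0.
have c0 c' : coefc s.+1 t r (upd a (t%:Z * b) c') alpha0 = c'.
  rewrite /coefc ts0 big_geq // l0 /upd eqxx big1 ?divr1 ?mul1r // => l _.
  by rewrite ffunE big_geq.
have D1 a' : S a' (t%:Z * b) = cst (coefc s.+1 t r a' alpha0) * monom F h alpha0
    + \sum_(alpha \in @exponents s t M (t%:Z * b) `\ alpha0)
        cst (coefc s.+1 t r a' alpha) * monom F h alpha.
  by apply: (fsbigD1 alpha0) => //; apply: exponents_finite.
rewrite !D1 !c0 m0 mpolyC0 tofrac0 mul0r add0r addrC; congr (_ + _).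
apply: eq_fsbigr => alpha; rewrite inE => -[[walpha _] ne].
rewrite !coefc_upd //; apply/eqP => E; apply: ne.
all: have := weight_le_level alpha; rewrite walpha E gerDl lez_nat leqn0 => /eqP ts.
all: move: walpha; rewrite (tail_sum_eq0 ts) /weight /= big1 ?addr0.
all: try by move=> l _; rewrite ffunE muln0.
all: by move=> /mulfI -> //; rewrite -lt0n.
Qed.

End ExpansionUpdate.

(** * Homogeneous fractions whose denominators are powers of h *)

Lemma tofrac_inj (A : idomainType) : injective (@FracField.tofrac A).
Proof. by move=> x y /eqP; rewrite tofrac_eq => /eqP. Qed.

Section HomogeneousFractions.
Variables (n : nat) (K : numFieldType) (t : nat) (h : {mpoly K[n]}).
Hypotheses (h0 : h != 0) (h_homog : h \is t.-homog) (t0 : (0 < t)%N).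
Local Notation L := {fraction {mpoly K[n]}}.
Implicit Types (x y : L) (w : int).

(** Homogeneity of degree [w], possibly negative, in the localization of the polynomial ring at
    h. *)
Definition homog_frac w x := exists m k Q,
  [/\ Q \is k.-homog, k%:Z = w + (t * m)%N%:Z & x * h%:F ^+ m = Q%:F].

Let hF0 : h%:F != 0. Proof. by rewrite tofrac_eq0. Qed.

Lemma homog_frac_tofrac k Q : Q \is k.-homog -> homog_frac k%:Z Q%:F.
Proof. by move=> Qh; exists 0%N, k, Q; rewrite muln0 addr0 expr0 mulr1. Qed.

Lemma homog_frac0 w : homog_frac w 0.
Proof.
(* The power |w| of h makes the degree w + t |w| of the numerator nonnegative, as t >= 1. *)
exists (absz w), (absz (w + (t * absz w)%N%:Z)), 0; split; [exact: dhomog0| |].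
  have : (absz w <= t * absz w)%N by rewrite leq_pmull.
  by lia.
by rewrite mul0r tofrac0.
Qed.

Lemma homog_fracD w x y : homog_frac w x -> homog_frac w y -> homog_frac w (x + y).
Proof.
move=> [m [k [P [Ph kE PE]]]] [m' [k' [Q [Qh k'E QE]]]].
exists (m + m')%N, (k + t * m')%N, (P * h ^+ m' + Q * h ^+ m); split.
- apply: rpredD; first exact: dhomogM Ph (dhomogMn _ h_homog).
  have -> : (k + t * m' = k' + t * m)%N by lia.
  exact: dhomogM Qh (dhomogMn _ h_homog).
- by lia.
by rewrite exprD mulrDl tofracD !tofracM !tofracXn -PE -QE; ring.
Qed.

Lemma homog_fracM w w' x y :
  homog_frac w x -> homog_frac w' y -> homog_frac (w + w') (x * y).
Proof.
move=> [m [k [P [Ph kE PE]]]] [m' [k' [Q [Qh k'E QE]]]].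
exists (m + m')%N, (k + k')%N, (P * Q); split; [exact: dhomogM|lia|].
by rewrite exprD tofracM -PE -QE; ring.
Qed.

Lemma homog_frac_cstM w c x : homog_frac w x -> homog_frac w ((c%:MP_[n])%:F * x).
Proof.
move=> [m [k [P [Ph kE PE]]]]; exists m, k, (c *: P); split => //.
  exact: dhomogZ.
by rewrite -mulrA PE -mul_mpolyC tofracM.
Qed.

Lemma homog_frac_exprz (b : int) : homog_frac (t%:Z * b) (h%:F ^ b).
Proof.
case: b => k.
  by rewrite -PoszM -exprnP -tofracXn; apply/homog_frac_tofrac/dhomogMn.
exists k.+1, 0%N, 1; split; [exact: dhomog1|lia|].
by rewrite mulVf ?expf_neq0.
Qed.

Lemma homog_frac_monom s (F : nat -> {mpoly K[n]}) (alpha : exponent s) :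
  (forall l, (l < s)%N -> F l.+1 \is l.+1.-homog) ->
  homog_frac (weight t alpha) (monom F h alpha).
Proof.
move=> Fh; rewrite /weight addrC; apply: homog_fracM; last exact: homog_frac_exprz.
elim/big_rec2: _ => [|l x w _ IH].
  by rewrite -tofrac1; apply/homog_frac_tofrac/dhomog1.
rewrite PoszD; apply: homog_fracM => //.
by rewrite -tofracXn; apply/homog_frac_tofrac/dhomogMn/Fh.
Qed.

Lemma homog_frac_expansion s r (F : nat -> {mpoly K[n]}) M a w :
  (forall l, (l < s)%N -> F l.+1 \is l.+1.-homog) ->
  homog_frac w (@expansion n K s t r F h M a w).
Proof.
move=> Fh; rewrite /expansion fsbig_finite; last exact: exponents_finite.
rewrite big_seq; apply: big_ind => [|x y|alpha].
- exact: homog_frac0.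
- exact: homog_fracD.
rewrite in_fset_set ?inE; last exact: exponents_finite.
by move=> [<- _]; apply/homog_frac_cstM/homog_frac_monom.
Qed.
End HomogeneousFractions.

(** * Homogeneous fractions whose differential is proportional to dh *)

Section Dependent.
Variables (n : nat) (K : numClosedFieldType) (t : nat) (h : {mpoly K[n]}).
Hypotheses (h0 : h != 0) (h_homog : h \is t.-homog) (t0 : (0 < t)%N).
Hypothesis h_not_power : forall p k, (1 < k)%N -> h <> p ^+ k.

Lemma homog_frac_dependent w x : homog_frac t h w x ->
  (forall i j, (h^`M(i))%:F * pder j x = (h^`M(j))%:F * pder i x) ->
  x != 0 -> (t %| w)%Z /\ exists c, x = (c%:MP_[n])%:F * h%:F ^ (w %/ t)%Z.
Proof.
move=> [m [k [Q [Qh kE QE]]]] dx x0.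
have hF0 : h%:F != 0 by rewrite tofrac_eq0.
have Q0 : Q != 0.
  apply/eqP => Q0; case/eqP: x0; apply: (mulIf (expf_neq0 m hF0)).
  by rewrite QE Q0 tofrac0 mul0r.
have pQ j : (Q^`M(j))%:F =
    pder j x * h%:F ^+ m + x * (m%:R * h%:F ^+ m.-1) * (h^`M(j))%:F.
  by rewrite -pder_tofrac -QE pderM pderXn pder_tofrac mulrA.
have dQ i j : h^`M(i) * Q^`M(j) = h^`M(j) * Q^`M(i).
  apply: tofrac_inj; rewrite tofracM [RHS]tofracM !pQ.
  move: (pder i x) (pder j x) (dx i j) (_ * (_ * _)) (_ ^+ m) => p q E y z.
  rewrite !mulrDr !mulrA E; congr (_ + _).
  by rewrite [LHS]mulrAC [RHS]mulrAC; congr (_ * _); apply: mulrC.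
have [tk [c Qc]] := homog_dependent t0 h0 h_homog Q0 Qh h_not_power dQ.
have kE' : w = (k %/ t)%N%:Z * t - m%:Z * t.
  by move: kE; rewrite -PoszM divnK //; lia.
have Ew : w = ((k %/ t)%N%:Z - m%:Z) * t%:Z by rewrite mulrBl.
split; first by rewrite Ew dvdz_mull.
exists c; rewrite Ew mulzK ?eqz_nat -?lt0n //.
apply: (mulIf (expf_neq0 m hF0)); rewrite QE Qc -mul_mpolyC tofracM tofracXn -mulrA.
by rewrite exprnP [in RHS]exprnP -expfzDr // subrK.
Qed.
End Dependent.

(** * Construction of the constants by descending induction *)

Section DescendingInduction.
Variables (n : nat) (K : numClosedFieldType) (s t r N : nat).
Variables (h : {mpoly K[n]}) (A B : nat -> {mpoly K[n]}) (aN : K).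
Hypotheses (h0 : h != 0) (t0 : (0 < t)%N) (h_homog : h \is t.-homog).
Hypothesis h_not_power : forall p k, (1 < k)%N -> h <> p ^+ k.
Hypotheses (tr : (t * r = s.+1)%N) (Atop : A s.+1 = h ^+ r).
Hypothesis A_homog : forall k, (k <= s)%N -> A k.+1 \is k.+1.-homog.
Hypothesis B_homog : forall l, B l.+1 \is l.+1.-homog.
Hypothesis B_gt : forall l, (N < l)%N -> B l = 0.
Hypotheses (tN : (t %| N)%N) (BN : B N = aN *: h ^+ (N %/ t)).
Local Notation S a w := (@expansion n K s t r A h N%:Z a w).
Local Notation cst c := ((c%:MP_[n])%:F : {fraction {mpoly K[n]}}).

Lemma top_difference_bracket a (e : nat) :
  (forall p q, \sum_(k < s.+1) ((A k.+1)^`M(p) * (B (s - k + e).+1)^`M(q)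
     - (A k.+1)^`M(q) * (B (s - k + e).+1)^`M(p)) = 0) ->
  (forall j, (e.+1 < j <= N)%N -> (B j)%:F = S a j%:Z) ->
  forall p q, let x := (B e.+1)%:F - S a e.+1%:Z in
  (h^`M(p))%:F * pder q x = (h^`M(q))%:F * pder p x.
Proof.
move=> brB Ba p q x.
have brS := expansion_bracket N%:Z a h0 t0 tr Atop p q (s.+1 + e.+1)%N%:Z.
pose y k := (B (s - k + e).+1)%:F - S a (s - k + e).+1%:Z.
have ybr : \sum_(k < s.+1) (((A k.+1)^`M(p))%:F * pder q (y k)
    - ((A k.+1)^`M(q))%:F * pder p (y k)) = 0.
  have := congr1 (@FracField.tofrac _) (brB p q).
  rewrite tofrac0 raddf_sum /= => brF; apply: etrans (subrr 0).
  rewrite -{3}brS -{2}brF -sumrB; apply: eq_bigr => k _.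
  have -> : (s.+1 + e.+1)%N%:Z - k.+1%:Z = (s - k + e).+1%:Z.
    by have := ltn_ord k; lia.
  rewrite tofracB !tofracM /y !pderB !pder_tofrac !mulrBr.
  move: (_ * _) (_ * _) (_ * _) (_ * _) => c1 c2 c3 c4.
  by rewrite !opprB addrACA [RHS]addrACA [X in _ + X]addrC.
(* For k < s the index s - k + e + 1 exceeds e + 1: up to N the induction hypothesis applies, and
   beyond N both terms are zero. Only the top component h^r survives. *)
have y0 (k : 'I_s) : y k = 0.
  rewrite /y; have ks := ltn_ord k.
  have [le_N|gt_N] := leqP (s - k + e).+1 N.
    by rewrite Ba ?subrr //; lia.
  by rewrite B_gt // tofrac0 expansion_gt ?subrr.
move: ybr; rewrite big_ord_recr /= big1 ?add0r => [|k _]; last first.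
  by rewrite y0 -tofrac0 !pder_tofrac !mderiv0 !tofrac0 !mulr0 subrr.
rewrite /y subnn add0n -/x => /eqP; rewrite subr_eq0 => /eqP.
rewrite Atop -!pder_tofrac tofracXn !pderXn !pder_tofrac -!mulrA.
have r0 : (0 < r)%N by move: tr; case: r => //; rewrite muln0.
have hr0 : r%:R * h%:F ^+ r.-1 != 0.
  rewrite mulf_neq0 ?expf_neq0 ?tofrac_eq0 //.
  by rewrite -tofrac_mpolyC_nat tofrac_eq0 mpolyC_eq0 pnatr_eq0 -lt0n.
by move=> E; apply: (mulfI hr0); rewrite -!mulrA.
Qed.

Lemma expansion_exists i : (0 < i <= N)%N ->
  (forall e, (i <= e.+1 <= N)%N -> forall p q,
     \sum_(k < s.+1) ((A k.+1)^`M(p) * (B (s - k + e).+1)^`M(q)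
       - (A k.+1)^`M(q) * (B (s - k + e).+1)^`M(p)) = 0) ->
  exists a : int -> K, [/\ a N%:Z = aN,
    forall j, (i <= j <= N)%N -> (B j)%:F = S a j%:Z
    & forall j, (i <= j <= N)%N -> ~~ (t %| j)%N -> a j%:Z = 0].
Proof.
move=> iN brB.
suff H u : (u <= N - i)%N -> exists a : int -> K, [/\ a N%:Z = aN,
    forall j, (N - u <= j <= N)%N -> (B j)%:F = S a j%:Z
    & forall j, (N - u <= j <= N)%N -> ~~ (t %| j)%N -> a j%:Z = 0].
  have [a [aE aS a0]] := H _ (leqnn _); have E : (N - (N - i) = i)%N by lia.
  by exists a; split => // j; rewrite -{1}E; [apply: aS|apply: a0].
elim: u => [_|u IH uN].
  exists (upd (fun=> 0) N%:Z aN); split=> [|j jN|j jN]; first by rewrite /upd eqxx.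
    have -> : j = N by lia.
    have EN : N%:Z = t%:Z * (N %/ t)%N%:Z by rewrite -PoszM mulnC divnK.
    rewrite BN EN expansion_upd_dvd //.
    rewrite expansion_zero ?add0r => [|k]; last by rewrite /upd; case: ifP.
    by rewrite -mul_mpolyC tofracM tofracXn exprnP.
  have -> : j = N by lia.
  by rewrite tN.
have [a [aE aS a0]] := IH (ltnW uN).
pose e := (N - u.+1).-1; have eE : (N - u.+1 = e.+1)%N by rewrite /e; lia.
rewrite eE; have eN : (e.+1 < N)%N by lia.
have up c j : (e.+1 < j)%N -> S (upd a e.+1%:Z c) j%:Z = S a j%:Z.
  by move=> ej; apply: expansion_upd_gt.
have upa c j : (e.+1 < j)%N -> upd a e.+1%:Z c j%:Z = a j%:Z.
  by move=> ej; rewrite /upd eqz_nat gtn_eqF.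
(* With a_(e+1) set to 0, [x] is exactly what a_(e+1) h^((e+1)/t) has to supply. *)
pose x := (B e.+1)%:F - S (upd a e.+1%:Z 0) e.+1%:Z.
have brx p q : (h^`M(p))%:F * pder q x = (h^`M(q))%:F * pder p x.
  apply: top_difference_bracket => [p' q'|j ej]; first by apply: brB; lia.
  by rewrite up ?aS //; lia.
have x_homog : homog_frac t h e.+1%:Z x.
  apply: homog_fracD => //; first exact: homog_frac_tofrac.
  rewrite -mulN1r -tofrac1 -tofracN -mpolyC1 -mpolyCN; apply: homog_frac_cstM.
  by apply: homog_frac_expansion => // l ls; apply/A_homog/ltnW.
suff [c cS c0] : exists2 c, (B e.+1)%:F = S (upd a e.+1%:Z c) e.+1%:Z
    & ~~ (t %| e.+1)%N -> c = 0.
  exists (upd a e.+1%:Z c); split=> [|j ejN|j ejN tj].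
  - by rewrite upa.
  - have [<-//|ne] := eqVneq e.+1 j; have ej : (e.+1 < j)%N by lia.
    by rewrite up // aS //; lia.
  have [E|ne] := eqVneq e.+1 j.
    by rewrite -E /upd eqxx c0 // E.
  by rewrite upa ?a0 //; lia.
(* If x = 0, the constant 0 works whether or not t divides e + 1; if x is nonzero, the divisibility
   is forced. *)
have [x0|xn0] := eqVneq x 0.
  by exists 0 => //; apply/eqP; rewrite -subr_eq0; apply/eqP.
have [te [c xE]] := homog_frac_dependent h0 h_homog t0 h_not_power x_homog brx xn0.
have te' : (t %| e.+1)%N by [].
exists c; last by rewrite te'.
have Ee : e.+1%:Z = t%:Z * (e.+1%:Z %/ t%:Z)%Z by rewrite mulrC divzK.
rewrite Ee expansion_upd_dvd // -?Ee; last by rewrite lez_nat ltnW.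
by rewrite -xE /x addrC subrK.
Qed.
End DescendingInduction.

(** * Translation of the degree hypotheses, and the theorem *)

Lemma deg_posz (n : nat) (K : nzRingType) (p : {mpoly K[n]}) (k : nat) :
  deg p = (k%:Z)%:E -> p != 0 /\ (msize p).-1 = k.
Proof. by rewrite /deg; case: ifPn => // p0 [->]. Qed.

Lemma msize_le_deg (n : nat) (K : nzRingType) (p : {mpoly K[n]}) (k : nat) :
  (deg p < (k%:Z)%:E)%E -> (msize p <= k)%N.
Proof.
rewrite /deg; case: eqVneq => [->|p0]; first by rewrite msize0.
by rewrite lte_fin ltz_nat; case: (msize p).
Qed.

(** If h = p^k with k > 1, then deg h = k deg p is positive, so p automatically has smaller degree
    than h. *)
Lemma not_power_deg (n : nat) (K : idomainType) (h : {mpoly K[n]}) t :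
  (0 < t)%N -> deg h = (t%:Z)%:E ->
  (forall (p : {mpoly K[n]}) k, (deg p < deg h)%E -> h <> p ^+ k) ->
  forall (p : {mpoly K[n]}) k, (1 < k)%N -> h <> p ^+ k.
Proof.
move=> t0 ht hpow p k k1 hp; apply: (hpow p k) => //; rewrite ht.
have [h0 <-] := deg_posz ht; rewrite /deg; case: eqVneq => [//|p0].
have mt : mdeg (mlead h) = t.
  by have := mlead_deg h0; have [_ <-] := deg_posz ht; move=> <-.
rewrite lte_fin ltz_nat -(mlead_deg p0) -(mlead_deg h0) /=.
have : mdeg (mlead h) = (mdeg (mlead p) * k)%N by rewrite hp mleadX // mdegMn.
move=> E; move: mt; rewrite E => mt; rewrite -{1}[mdeg _]muln1 ltn_pmul2l //.
by move: t0; rewrite -mt muln_gt0 => /andP[].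
Qed.

Lemma poisson_deg_lt (n : nat) (K : comNzRingType) (f g : {mpoly K[n]}) (k : nat)
    (i j : 'I_n) :
  (poisson_deg f g < (k.+2%:Z)%:E)%E -> (i < j)%N ->
  (msize (f^`M(i) * g^`M(j) - f^`M(j) * g^`M(i)) <= k)%N.
Proof.
move=> fg ij; apply: msize_le_deg.
pose e : {e : 'I_n * 'I_n | (e.1 < e.2)%N} := exist _ (i, j) ij.
have : (2%:E + deg (poisson f g e) < (k.+2%:Z)%:E)%E.
  apply: le_lt_trans fg; rewrite /poisson_deg leeD2l //.
  exact: (le_bigmax _ (fun e => deg (poisson f g e))).
rewrite ffunE /=; case: (deg _) => [m||] //=.
by rewrite -EFinD !lte_fin; lia.
Qed.

Unset Implicit Arguments.

Theorem theorem4p2 (R : realType) (n d N s t r : nat)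
    (F G h : {mpoly R[i][n]}) (Fc Gc : nat -> {mpoly R[i][n]}) (aN : R[i])
    (d_ge1 : (1 <= d)%N) (N_ge1 : (1 <= N)%N) (def_s : s = (d - 1)%N)
    (Fc_homog : forall l : nat, (1 <= l <= d)%N -> Fc l \is l.-homog)
    (Gc_homog : forall j : nat, (1 <= j <= N)%N -> Gc j \is j.-homog)
    (def_F : F = \sum_(1 <= l < s.+1) Fc l + Fc d)
    (def_G : G = \sum_(1 <= j < N.+1) Gc j)
    (def_t : deg h = (t%:Z)%:E)
    (h_homog : h \is t.-homog)
    (h_not_power : forall (p : {mpoly R[i][n]}) (k : nat),
        (deg p < deg h)%E -> h <> p ^+ k)
    (t_dvd : (t %| gcdn d N)%N)
    (def_r : r = (d %/ t)%N)
    (Fd_eq : Fc d = h ^+ (d %/ t))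
    (aN_neq0 : aN <> 0)
    (GN_eq : Gc N = aN *: h ^+ (N %/ t))
    (i : nat) (i_bounds : (1 <= i <= N)%N)
    (deg_bracket : (poisson_deg F G < ((d + i)%N%:Z)%:E)%E) :
  exists a : int -> R[i],
    a N%:Z = aN /\
    (forall j : nat, (i <= j <= N)%N ->
       (Gc j)%:F =
       \sum_(alpha \in @admissible s d N t j)
          ((coefc d t r a alpha)%:MP_[n])%:F * monom Fc h alpha) /\
    (forall j : nat, (i <= j <= N)%N -> ~~ (t %| j)%N -> a j%:Z = 0).
Proof.
have t0 : (0 < t)%N.
  by rewrite lt0n; apply: contraTneq t_dvd => ->; rewrite dvd0n -lt0n gcdn_gt0 d_ge1.
have [h0 _] := deg_posz def_t.
have h_not_power' := not_power_deg t0 def_t h_not_power.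
have [td tN] : (t %| d)%N /\ (t %| N)%N by apply/andP; rewrite -dvdn_gcd.
have ds : d = s.+1 by move: def_s d_ge1; lia.
clear def_s; subst d.
have tr : (t * r = s.+1)%N by rewrite def_r mulnC divnK.
rewrite -def_r in Fd_eq.
(* [Gc] is constrained only up to N, so it is cut off there. *)
pose B l := if (l <= N)%N then Gc l else 0.
have A_homog k : (k <= s)%N -> Fc k.+1 \is k.+1.-homog by move=> ks; apply: Fc_homog.
have B_homog l : B l.+1 \is l.+1.-homog.
  by rewrite /B; case: ifP => lN; [apply: Gc_homog|apply: dhomog0].
have B_gt l : (N < l)%N -> B l = 0 by rewrite /B ltnNge => /negbTE ->.
have FE : F = \sum_(k < s.+1) Fc k.+1.
  by rewrite def_F big_add1 big_mkord big_ord_recr.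
have GE : G = \sum_(l < N) B l.+1.
  by rewrite def_G big_add1 big_mkord; apply: eq_bigr => l _; rewrite /B ltn_ord.
have brB e : (i <= e.+1 <= N)%N -> forall p q,
    \sum_(k < s.+1) ((Fc k.+1)^`M(p) * (B (s - k + e).+1)^`M(q)
      - (Fc k.+1)^`M(q) * (B (s - k + e).+1)^`M(p)) = 0.
  move=> ie.
  have lt_pq (p q : 'I_n) : (p < q)%N -> \sum_(k < s.+1)
      ((Fc k.+1)^`M(p) * (B (s - k + e).+1)^`M(q)
      - (Fc k.+1)^`M(q) * (B (s - k + e).+1)^`M(p)) = 0.
    (* The degree bound suffices because d + i <= d + (e + 1) = s + e + 2. *)
    move=> pq; apply: (bracket_component A_homog B_homog (fun l => @B_gt l.+1)).
    rewrite -FE -GE; apply: (poisson_deg_lt _ pq).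
    by apply: lt_le_trans deg_bracket _; rewrite lee_fin lez_nat; lia.
  move=> p q; have [/lt_pq//|qp|/val_inj->] := ltngtP p q.
    have /(congr1 -%R) := lt_pq _ _ qp.
    rewrite oppr0 -sumrN => E; apply: etrans E; apply: eq_bigr => k _.
    by rewrite opprB.
  by rewrite big1 // => k _; rewrite subrr.
have BN : B N = aN *: h ^+ (N %/ t) by rewrite /B leqnn.
have [a [aE aS a0]] :=
  expansion_exists h0 t0 h_homog h_not_power' tr Fd_eq A_homog B_homog B_gt tN BN
    i_bounds brB.
exists a; split=> //; split=> // j ijN.
(* For d = s + 1 the set [admissible] is convertible to [exponents] with bound N and weight j. *)
by have := aS j ijN; rewrite /B (proj2 (andP ijN)).
Qed.
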